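(* Let $\mathcal{A}$ be a unital $C^*$-algebra and let $F \in \mathcal{M}\Phi(H_{\mathcal{A}})$. Suppose that there are two decompositions of the domain and the range $$H_{\mathcal{A}} = M_1 \tilde\oplus N_1 \stackrel{F}{\longrightarrow} M_2 \tilde\oplus N_2 = H_{\mathcal{A}}, \qquad H_{\mathcal{A}} = M_1' \tilde\oplus N_1' \stackrel{F}{\longrightarrow} M_2' \tilde\oplus N_2' = H_{\mathcal{A}}$$ with respect to which $F$ has the matrices $\begin{bmatrix} F_1 & 0 \\ 0 & F_4\end{bmatrix}$ and $\begin{bmatrix} F_1' & 0 \\ 0 & F_4'\end{bmatrix}$ respectively, where $F_1: M_1 \to M_2$ and $F_1': M_1' \to M_2'$ are isomorphisms, $N_1, N_1', N_2$ are closed and finitely generated, and $N_2'$ is just closed. Then $N_2'$ is finitely generated as well.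
   Context: $\mathcal{A}$ is a unital $C^*$-algebra; $H_{\mathcal{A}} = \ell^2(\mathcal{A})$ is the standard Hilbert $\mathcal{A}$-module, and $B^a(H_{\mathcal{A}})$ is the $C^*$-algebra of bounded adjointable $\mathcal{A}$-linear operators on it. All submodules $M_i, N_i, M_i', N_i'$ in decompositions are closed; $M \tilde\oplus N$ denotes a direct sum of closed submodules that is not necessarily orthogonal. A Hilbert module is finitely generated if it is the (algebraic) $\mathcal{A}$-linear span of a finite set. An isomorphism of Hilbert modules is a bounded $\mathcal{A}$-linear bijection (with bounded inverse). That $F$ has a diagonal matrix with entries $F_1, F_4$ with respect to $M_1 \tilde\oplus N_1 \to M_2 \tilde\oplus N_2$ means $F(M_1)\subseteq M_2$, $F(N_1)\subseteq N_2$, $F_1=F|_{M_1}$, $F_4=F|_{N_1}$. $F \in B^a(H_{\mathcal{A}})$ belongs to $\mathcal{M}\Phi(H_{\mathcal{A}})$ ($F$ is $\mathcal{A}$-Fredholm) if there is a decomposition $H_{\mathcal{A}} = M_1 \tilde\oplus N_1 \to M_2 \tilde\oplus N_2 = H_{\mathcal{A}}$ into closed submodules with respect to which $F$ is diagonal with $F_1$ an isomorphism and $N_1, N_2$ finitely generated. *)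

(* Defs.v *)
From HB Require Import structures.
From mathcomp Require Import all_boot all_order all_algebra.
From mathcomp Require Import all_classical all_reals all_analysis.
From mathcomp Require Import complex.

Set Implicit Arguments.
Unset Strict Implicit.
Unset Printing Implicit Defensive.

Import Order.TTheory GRing.Theory Num.Theory.
Import numFieldNormedType.Exports.

Local Open Scope classical_set_scope.
Local Open Scope ring_scope.
Local Open Scope complex_scope.

(* Unital C*-algebras over the complex numbers R[i], possibly zero. Norms take
   values in the nonnegative reals of R[i]. Hierarchy-Builder cannot join the
   library's rings and normed modules outside of numDomainType, so the product
   and the unit are fields of the mixin, from which a canonical pzRingType
   structure is built. *)
HB.mixin Record isCStarAlgebra (R : realType) A
    & CompleteNormedModule R[i] A := {
  cstar_one : A;
  cstar_mul : A -> A -> A;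
  star : A -> A;
  cstar_mulA : associative cstar_mul;
  cstar_mul1l : left_id cstar_one cstar_mul;
  cstar_mul1r : right_id cstar_one cstar_mul;
  cstar_mulDl : left_distributive cstar_mul +%R;
  cstar_mulDr : right_distributive cstar_mul +%R;
  cstar_scaleAl : forall (c : R[i]) (x y : A),
    c *: cstar_mul x y = cstar_mul (c *: x) y;
  cstar_scaleAr : forall (c : R[i]) (x y : A),
    c *: cstar_mul x y = cstar_mul x (c *: y);
  starK : involutive star;
  starD : {morph star : x y / x + y};
  starZ : forall (c : R[i]) (x : A), star (c *: x) = Num.conj c *: star x;
  starM : forall x y : A, star (cstar_mul x y) = cstar_mul (star y) (star x);
  cstar_normM : forall x y : A, `|cstar_mul x y| <= `|x| * `|y|;
  cstar_norm_star : forall x : A, `|cstar_mul (star x) x| = `|x| ^+ 2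
}.

#[short(type="cstarAlgType")]
HB.structure Definition CStarAlgebra (R : realType) :=
  {A of CompleteNormedModule R[i] A & isCStarAlgebra R A}.

HB.instance Definition _ (R : realType) (A : cstarAlgType R) :=
  GRing.Zmodule_isPzRing.Build A (@cstar_mulA R A) (@cstar_mul1l R A)
    (@cstar_mul1r R A) (@cstar_mulDl R A) (@cstar_mulDr R A).

Section StandardModule.
Context {R : realType} {A : cstarAlgType R}.

(* H_A is the right Hilbert A-module of the sequences x : nat -> A satisfying
   the predicate l2. Addition of sequences is pointwise; the complex scalar c
   acts on H_A as the element c *: 1 of A. Submodules of H_A are sets of
   sequences included in l2; operators are functions on all sequences, whose
   values outside their domain are irrelevant. *)
Implicit Types (x y : nat -> A) (M N : set (nat -> A)).
Implicit Types (F G : (nat -> A) -> nat -> A).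

Definition rscale x (a : A) : nat -> A := fun n => x n * a.

Definition l2 : set (nat -> A) :=
  [set x | cvgn (series (fun n => star (x n) * x n))].

(* The series converges for x and y in l2, by the Cauchy-Schwarz inequality. *)
Definition inner x y : A := limn (series (fun n => star (x n) * y n)).

Definition hnorm x : R[i] := sqrtC `|inner x x|.

Definition submodule M :=
  [/\ M `<=` l2, M 0, (forall x y, M x -> M y -> M (x + y))
    & (forall x a, M x -> M (rscale x a))].

Definition norm_closed M :=
  forall x, l2 x ->
    (forall e : R[i], 0 < e -> exists2 y, M y & hnorm (x - y) < e) -> M x.

Definition closed_submodule M := submodule M /\ norm_closed M.

Definition direct_sum M N :=
  [/\ closed_submodule M, closed_submodule N, M `&` N = [set 0]
    & [set x + y | x in M & y in N] = l2].

Definition finitely_generated N :=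
  exists (n : nat) (g : 'I_n -> nat -> A),
    N = [set x | exists a : 'I_n -> A, x = \sum_(i < n) rscale (g i) (a i)].

Definition linear_on M F :=
  (forall x y, M x -> M y -> F (x + y) = F x + F y) /\
  (forall x a, M x -> F (rscale x a) = rscale (F x) a).

Definition bounded_on M F :=
  exists c : R[i], forall x, M x -> hnorm (F x) <= c * hnorm x.

(* F belongs to B^a(H_A). *)
Definition bounded_adjointable F :=
  [/\ (forall x, l2 x -> l2 (F x)), linear_on l2 F, bounded_on l2 F
    & exists G, (forall y, l2 y -> l2 (G y)) /\
        (forall x y, l2 x -> l2 y -> inner (F x) y = inner x (G y))].

(* The restriction of F is an isomorphism of Hilbert modules from M to N. *)
Definition isomorphism_on M N F :=
  [/\ linear_on M F, bounded_on M F, set_bij M N F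
    & exists G, (forall x, M x -> G (F x) = x) /\ bounded_on N G].

(* With respect to the decompositions M1 + N1 -> M2 + N2 of H_A, F is diagonal
   and its first diagonal entry is an isomorphism. *)
Definition diagonal_iso F M1 N1 M2 N2 :=
  [/\ direct_sum M1 N1, direct_sum M2 N2, F @` M1 `<=` M2, F @` N1 `<=` N2
    & isomorphism_on M1 M2 F].

(* The class MPhi(H_A) of A-Fredholm operators. *)
Definition fredholm F :=
  bounded_adjointable F /\
  exists M1 N1 M2 N2, [/\ diagonal_iso F M1 N1 M2 N2,
    finitely_generated N1 & finitely_generated N2].

End StandardModule.

(* Main.v *)
Require Import Defs.
From mathcomp Require Import all_boot all_order all_algebra.
From mathcomp Require Import all_classical all_reals all_analysis.

(** The argument is purely algebraic.  Since [M2 = F M1], the codomain is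
    [l2 = M2 + N2 = F M1 + N2], and [F M1] lies in
    [F (M1' + N1') = F M1' + F N1'], which is included in [M2' + F N1'].
    Hence [F N1' + N2], which is finitely generated, spans the codomain
    modulo [M2'].  The projection onto [N2'] along [M2'] is [A]-linear and
    kills [M2'], so it maps [F N1' + N2] onto [N2'], and a linear image of a
    finitely generated module is finitely generated.  The last step is
    [finitely_generated_complement], which rests on [direct_sum_projection]
    and [finitely_generated_image]. *)

Set Implicit Arguments.
Unset Strict Implicit.
Unset Printing Implicit Defensive.

Import GRing.Theory.

Local Open Scope classical_set_scope.
Local Open Scope ring_scope.

Section Submodules.
Context {R : realType} {A : cstarAlgType R}.
Implicit Types (x y : nat -> A) (a : A) (M N K : set (nat -> A)).
Implicit Types (F P : (nat -> A) -> nat -> A).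

Lemma rscaleDl x y a : rscale (x + y) a = rscale x a + rscale y a.
Proof. by apply/funext => n; rewrite /rscale /= mulrDl. Qed.

Lemma rscaler0 x : rscale x 0 = 0.
Proof. by apply/funext => n; rewrite /rscale mulr0. Qed.

Lemma rscaler1 x : rscale x 1 = x.
Proof. by apply/funext => n; rewrite /rscale mulr1. Qed.

Lemma rscalerN1 x : rscale x (- 1) = - x.
Proof. by apply/funext => n; rewrite /rscale mulrN mulr1. Qed.

Lemma submoduleB M x y : submodule M -> M x -> M y -> M (x - y).
Proof.
move=> [_ _ MD MZ] Mx My.
by apply: MD => //; rewrite -rscalerN1; apply: MZ.
Qed.

Lemma linear_on_lincomb M F n (g : 'I_n -> nat -> A) (a : 'I_n -> A) :
  submodule M -> linear_on M F -> (forall i, M (g i)) ->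
  F (\sum_(i < n) rscale (g i) (a i)) = \sum_(i < n) rscale (F (g i)) (a i).
Proof.
move=> [_ M0 MD MZ] [FD FZ] Mg.
(* Membership in [M] is carried along, since [F] is additive only on [M]. *)
pose K x y := M x /\ F x = y.
suff [] : K (\sum_(i < n) rscale (g i) (a i))
  (\sum_(i < n) rscale (F (g i)) (a i)) by [].
apply: (big_ind2 K) => [|x1 x2 y1 y2 [Mx Fx] [My Fy]|i _].
- split=> //; have := FZ 0 0 M0; rewrite !rscaler0; exact.
- by split; [apply: MD | rewrite FD // Fx Fy].
- by split; [apply: MZ | rewrite FZ].
Qed.

Lemma generator_mem n (g : 'I_n -> nat -> A) i :
  exists a : 'I_n -> A, g i = \sum_(j < n) rscale (g j) (a j).
Proof.
exists (fun j => if j == i then 1 else 0).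
rewrite (bigD1 i) //= eqxx rscaler1 big1 ?addr0 // => j /negPf ->.
exact: rscaler0.
Qed.

Lemma finitely_generated_image M N F :
  submodule M -> N `<=` M -> linear_on M F ->
  finitely_generated N -> finitely_generated (F @` N).
Proof.
move=> Msub NM Flin [n [g Ng]].
have Mg i : M (g i) by apply: NM; rewrite Ng; exact: generator_mem.
exists n, (F \o g); apply/seteqP; split=> [_ [x + <-]|_ [a ->]].
  rewrite Ng => -[a ->]; exists a.
  exact: (linear_on_lincomb _ Msub Flin Mg).
exists (\sum_(i < n) rscale (g i) (a i)); first by rewrite Ng; exists a.
exact: (linear_on_lincomb _ Msub Flin Mg).
Qed.

Lemma finitely_generated_add M N :
  finitely_generated M -> finitely_generated N ->
  finitely_generated [set x + y | x in M & y in N].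
Proof.
move=> [m [g ->]] [n [h ->]].
exists (m + n)%N.
exists (fun i => match fintype.split i with inl j => g j | inr k => h k end).
apply/seteqP; split=> [_ [_ [a ->] [_ [b ->] <-]]|_ [c ->]].
  exists (fun i => match fintype.split i with inl j => a j | inr k => b k end).
  rewrite big_split_ord /=; congr (_ + _); apply: eq_bigr => i _.
    by rewrite (unsplitK (inl i)).
  by rewrite (unsplitK (inr i)).
exists (\sum_(i < m) rscale (g i) (c (lshift n i))).
  by exists (c \o lshift n).
exists (\sum_(i < n) rscale (h i) (c (rshift m i))).
  by exists (c \o @rshift m n).
rewrite big_split_ord /=; congr (_ + _); apply: eq_bigr => i _.
  by rewrite (unsplitK (inl i)).
by rewrite (unsplitK (inr i)).
Qed.

(** Closure of [l2] under addition is in general a consequence of the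
    Cauchy-Schwarz inequality; a decomposition of [l2] gives it directly,
    because a sum of submodules is closed under addition. *)
Lemma direct_sum_submodule_l2 M N : direct_sum M N -> submodule (@l2 R A).
Proof.
move=> [[[Ml2 M0 MD MZ] _] [[Nl2 N0 ND NZ] _] _ MNl2].
split=> //; first exact: Ml2.
- rewrite -MNl2 => _ _ [u Mu [v Nv <-]] [u' Mu' [v' Nv' <-]].
  exists (u + u'); first exact: MD.
  by exists (v + v'); [exact: ND | rewrite addrACA].
- rewrite -MNl2 => _ a [u Mu [v Nv <-]].
  exists (rscale u a); first exact: MZ.
  by exists (rscale v a); [exact: NZ | rewrite rscaleDl].
Qed.

(** A point [y] of [N] with [x - y] in [M] is unique because [M] meets [N]
    trivially; choosing it for each [x] thus gives a linear map. *)
Lemma direct_sum_projection M N : direct_sum M N ->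
  exists P, linear_on l2 P /\ forall x y, M x -> N y -> P (x + y) = y.
Proof.
move=> [[Msub _] [Nsub _] MN0 MNl2].
have [Ml2 M0 MD MZ] := Msub; have [Nl2 N0 ND NZ] := Nsub.
have uniqN x1 y1 x2 y2 :
    M x1 -> N y1 -> M x2 -> N y2 -> x1 + y1 = x2 + y2 -> y1 = y2.
  move=> Mx1 Ny1 Mx2 Ny2 e.
  suff : (M `&` N) (y1 - y2) by rewrite MN0 => /subr0_eq.
  split; last exact: submoduleB.
  suff -> : y1 - y2 = x2 - x1 by exact: submoduleB.
  by apply/eqP; rewrite subr_eq addrAC -e addrAC subrr add0r.
have /choice[P PP] : forall x, exists y, l2 x -> N y /\ M (x - y).
  move=> x; have [|nx] := pselect (l2 x); last by exists 0.
  by rewrite -MNl2 => -[u Mu [v Nv <-]]; exists v; rewrite addrK.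
have Padd x y : M x -> N y -> P (x + y) = y.
  move=> Mx Ny.
  have [|NP MP] := PP (x + y); first by rewrite -MNl2; exists x => //; exists y.
  by apply: (uniqN _ _ x y MP NP Mx Ny); rewrite subrK.
exists P; split=> //; split=> [x y|x a]; rewrite -MNl2.
  move=> [u Mu [v Nv <-]] [u' Mu' [v' Nv' <-]].
  by rewrite addrACA !Padd //; [exact: MD | exact: ND].
move=> [u Mu [v Nv <-]].
by rewrite rscaleDl !Padd //; [exact: MZ | exact: NZ].
Qed.

(** Modulo [M], the module [K] is everything, so the projection along [M]
    still maps [K] onto the complement [N] of [M]. *)
Lemma finitely_generated_complement M N K :
  direct_sum M N -> K `<=` l2 -> l2 `<=` [set x + y | x in M & y in K] ->
  finitely_generated K -> finitely_generated N.
Proof.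
move=> MN Kl2 l2MK Kfg.
have l2sub := direct_sum_submodule_l2 MN.
have [P [Plin Padd]] := direct_sum_projection MN.
have [[Msub _] [Nsub _] _ MNl2] := MN.
have [Ml2 M0 _ _] := Msub; have [Nl2 N0 _ _] := Nsub.
have PN y : N y -> P y = y by move=> Ny; rewrite -[in LHS](add0r y) Padd.
have PM x : M x -> P x = 0 by move=> Mx; rewrite -[x]addr0 Padd.
suff -> : N = P @` K by exact: finitely_generated_image l2sub Kl2 Plin Kfg.
apply/seteqP; split=> [y Ny|_ [k Kk <-]].
  have [x Mx [k Kk xky]] := l2MK _ (Nl2 _ Ny).
  exists k => //; rewrite -[RHS](PN _ Ny) -xky.
  by rewrite (Plin.1 _ _ (Ml2 _ Mx) (Kl2 _ Kk)) (PM _ Mx) add0r.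
have := Kl2 _ Kk; rewrite -MNl2 => -[x Mx [y Ny <-]].
by rewrite Padd.
Qed.

End Submodules.

Theorem lemma2p16 (R : realType) (A : cstarAlgType R)
    (F : (nat -> A) -> nat -> A)
    (M1 N1 M2 N2 M1' N1' M2' N2' : set (nat -> A)) :
  fredholm F ->
  diagonal_iso F M1 N1 M2 N2 ->
  diagonal_iso F M1' N1' M2' N2' ->
  finitely_generated N1 ->
  finitely_generated N1' ->
  finitely_generated N2 ->
  finitely_generated N2'.
Proof.
move=> [[Fl2 Flin _ _] _] [MN1 MN2 _ _ [_ _ [_ _ FM1] _]].
move=> [MN1' MN2' FM1' _ _] _ N1'fg N2fg.
have l2sub := direct_sum_submodule_l2 MN2.
have [_ _ l2D _] := l2sub.
have [[[M1l2 _ _ _] _] _ _ _] := MN1.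
have [[[M1'l2 _ _ _] _] [[N1'l2 _ _ _] _] _ MN1'l2] := MN1'.
have [_ [[N2l2 _ _ _] _] _ MN2l2] := MN2.
apply: (finitely_generated_complement
  (K := [set x + y | x in F @` N1' & y in N2]) MN2') => //.
- move=> _ [_ [w N1'w <-] [n N2n <-]].
  by apply: l2D; [apply/Fl2/N1'l2 | apply: N2l2].
- rewrite -[X in X `<=` _]MN2l2 => _ [m M2m [n N2n <-]].
  have [u M1u <-] := FM1 _ M2m.
  have := M1l2 _ M1u; rewrite -MN1'l2 => -[v M1'v [w N1'w <-]].
  rewrite Flin.1; [|exact: M1'l2|exact: N1'l2].
  exists (F v); first by apply: FM1'; exists v.
  exists (F w + n); last by rewrite addrA.
  by exists (F w); [exists w | exists n].
- by apply: finitely_generated_add => //; exact: finitely_generated_image Flin _.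
Qed.
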